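(* For each positive integer $m\ge2$ (and each positive integer $t$), there is a bijection $\Phi_m$ from $L_{4t,m}\cap R_{4t}$ to $C_{t,m}$, given by the diagram $$L_{4t,m}\cap R_{4t}\ \xleftarrow{\ \pi_m\ }\ \mathcal{L}_{4t,m}\cap\mathcal{N}_{4t}\ \xrightarrow{\ g_m\ }\ C_{t,m},$$ in which $\Phi_m$ is the (dashed) arrow from $L_{4t,m}\cap R_{4t}$ to $C_{t,m}$.
   Context: $G=\mathbb{Z}_2*\mathbb{Z}_3$, where $a$ generates $\mathbb{Z}_2$ and $b$ generates $\mathbb{Z}_3$. The word length of an element of $G$ is the minimum length of a word in $\{a,b,b^{-1}\}$ representing it; the length of a conjugacy class is the minimum word length of its elements. The set of reciprocal words is $\mathcal{R}=\{xy: x,y\text{ distinct order 2 elements of }G\}$, and $R_{4t}$ is the set of conjugacy classes of elements of $\mathcal{R}$ of length $4t$. A (bb)-word is a reduced word that begins with $b^{\pm1}$ and ends with $b^{\pm1}$. With $[x,y]=xyx^{-1}y^{-1}$, $\mathcal{N}_{4t}=\{[a,\gamma]:\gamma\text{ a (bb)-word of length }2t-1\}$. Every element of infinite order is conjugate to an (ab)-word $ab^{\epsilon_1}\cdots ab^{\epsilon_s}$, $\epsilon_i=\pm1$, unique up to cyclic permutation of $(\epsilon_1,\dots,\epsilon_s)$; it is $m$-low lying if no $m+1$ consecutive $\epsilon_i$, considered cyclically, have the same sign. $\mathcal{L}_{4t,m}$ is the set of $m$-low lying words of length $4t$, and $L_{4t,m}$ is the set of conjugacy classes of $m$-low lying words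 of length $4t$. A composition of $t$ is an ordered sequence of positive integers $(k_1,\dots,k_l)$ (its parts) summing to $t$; $C_t$ is the set of compositions of $t$ and $C_{t,m}$ the set of those with all parts at most $m$. The map $\pi:\mathcal{N}_{4t}\to R_{4t}$ sends an element to its conjugacy class. The map $g:\mathcal{N}_{4t}\to C_t$ sends $[a,b^{\epsilon_1}ab^{\epsilon_2}\cdots ab^{\epsilon_t}]$ to the ordered sequence $(k_1,\dots,k_l)$ of lengths of the $(+1)$- and $(-1)$-runs, starting from the left, in $\epsilon_1,\dots,\epsilon_t$. The maps $\pi_m$ and $g_m$ are the restrictions of $\pi$ and $g$ to $\mathcal{L}_{4t,m}\cap\mathcal{N}_{4t}$, with images $L_{4t,m}\cap R_{4t}$ and $C_{t,m}$; both are surjective and 2-to-1, although the preimage of a point under $\pi_m$ is generically not the preimage of a point under $g_m$. *)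

(* Defs.v *)
From HB Require Import structures.
From mathcomp Require Import all_boot.
From mathcomp Require Import boolp classical_sets functions.

Set Implicit Arguments.
Unset Strict Implicit.
Unset Printing Implicit Defensive.

Local Open Scope classical_set_scope.
Local Open Scope group_scope.

(* The free product Z_2 * Z_3.

    The group is realised by its normal forms: an element is a word in the
    non-trivial elements of the two factors, consecutive letters coming from
    different factors.  [LA] is the non-trivial element of Z_2, [LB true] and
    [LB false] are b and b^-1 in Z_3.  The universal property of the free
    product is [free_product_univ] below. *)

Inductive letter := LA | LB of bool.

Definition letter_code (l : letter) : option bool :=
  if l is LB e then Some e else None.
Definition letter_decode (o : option bool) : letter :=
  if o is Some e then LB e else LA.
Lemma letter_codeK : cancel letter_code letter_decode.
Proof. by case. Qed.

HB.instance Definition _ := Finite.copy letter (can_type letter_codeK).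

Definition is_b (l : letter) : bool := if l is LB _ then true else false.

Definition reduced (w : seq letter) : bool :=
  sorted (fun l l' => is_b l != is_b l') w.

(* Left multiplication of a normal form by one letter; b b = b^-1 and
   b^-1 b^-1 = b account for the [LB (~~ e)] branch. *)
Definition push (l : letter) (w : seq letter) : seq letter :=
  match l, w with
  | LA, LA :: w' => w'
  | LB e, LB e' :: w' => if e == e' then LB (~~ e) :: w' else w'
  | _, _ => l :: w
  end.

Definition inv_letter (l : letter) : letter :=
  if l is LB e then LB (~~ e) else LA.

Definition inv_word (w : seq letter) : seq letter := rev (map inv_letter w).

Lemma push_reduced l w : reduced w -> reduced (push l w).
Proof.
by case: l => [|[]]; case: w => [|[|[]] [|[|e] w]].
Qed.

Lemma act_reduced u w : reduced w -> reduced (foldr push w u).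
Proof. by move=> rw; elim: u => //= l u IH; exact: push_reduced. Qed.

Lemma push_act l u w : reduced w ->
  foldr push w (push l u) = push l (foldr push w u).
Proof.
move=> rw; case: l => [|e]; case: u => [|[|e'] u] //=.
  by have := act_reduced u rw; case: (foldr push w u) => [|[|c] [|[|d] v]].
have := act_reduced u rw.
by case: e; case: e' => /=; case: (foldr push w u) => [|[|[]] [|[|[]] v]].
Qed.

Lemma act_act u v w : reduced w ->
  foldr push (foldr push w v) u = foldr push w (foldr push v u).
Proof. by move=> rw; elim: u => //= l u ->; rewrite push_act. Qed.

Lemma act_cat u w : reduced (u ++ w) -> foldr push w u = u ++ w.
Proof.
elim: u => //= l u IH ruw; have ru : reduced (u ++ w).
  by move: ruw; rewrite /reduced /=; exact: path_sorted.
rewrite IH //; move: ruw; rewrite /reduced.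
by case: l; case: (u ++ w) => [|[|e] v].
Qed.

Lemma inv_wordK : involutive inv_word.
Proof.
move=> w; rewrite /inv_word map_rev revK -map_comp -[RHS]map_id.
by apply: eq_map => -[|[]].
Qed.

Lemma act_inv u w : reduced w -> foldr push (foldr push w u) (inv_word u) = w.
Proof.
elim: u w => //= l u IH w rw; rewrite /inv_word /= rev_cons foldr_rcons.
rewrite -[RHS]IH //; congr foldr.
have := act_reduced u rw.
by case: l => [|[]]; case: (foldr push w u) => [|[|[]] [|[|[]] v]].
Qed.

Lemma inv_reduced w : reduced w -> reduced (inv_word w).
Proof.
rewrite /reduced /inv_word rev_sorted sorted_map.
have is_bV l : is_b (inv_letter l) = is_b l by case: l.
by apply: sub_sorted => l l'; rewrite /= !is_bV eq_sym.
Qed.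

Record Z2Z3 := MkZ2Z3 { normal_form :> seq letter; _ : reduced normal_form }.

HB.instance Definition _ := [isSub for normal_form].
HB.instance Definition _ := [Choice of Z2Z3 by <:].

Lemma Z2Z3_reduced (x : Z2Z3) : reduced (val x).
Proof. by case: x. Qed.

Definition Z2Z3_one : Z2Z3 := @MkZ2Z3 [::] isT.
Definition Z2Z3_mul (x y : Z2Z3) : Z2Z3 :=
  MkZ2Z3 (act_reduced (val x) (Z2Z3_reduced y)).
Definition Z2Z3_inv (x : Z2Z3) : Z2Z3 := MkZ2Z3 (inv_reduced (Z2Z3_reduced x)).

Lemma Z2Z3_mulA : associative Z2Z3_mul.
Proof.
by move=> x y z; apply: val_inj; rewrite /= act_act //; exact: Z2Z3_reduced.
Qed.
Lemma Z2Z3_mul1 : left_id Z2Z3_one Z2Z3_mul.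
Proof. by move=> x; apply: val_inj. Qed.
Lemma Z2Z3_1mul : right_id Z2Z3_one Z2Z3_mul.
Proof.
move=> x; apply: val_inj; rewrite /= act_cat cats0 //; exact: Z2Z3_reduced.
Qed.
Lemma Z2Z3_mulV : left_inverse Z2Z3_one Z2Z3_inv Z2Z3_mul.
Proof.
move=> x; apply: val_inj => /=; rewrite -[X in foldr _ X _]cats0 -act_cat.
  exact: act_inv.
by rewrite cats0; exact: Z2Z3_reduced.
Qed.
Lemma Z2Z3_Vmul : right_inverse Z2Z3_one Z2Z3_inv Z2Z3_mul.
Proof.
move=> x; rewrite -[X in Z2Z3_mul X _](_ : Z2Z3_inv (Z2Z3_inv x) = x).
  exact: Z2Z3_mulV.
by apply: val_inj; exact: inv_wordK.
Qed.

HB.instance Definition _ := isGroup.Build Z2Z3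
  Z2Z3_mulA Z2Z3_mul1 Z2Z3_1mul Z2Z3_mulV Z2Z3_Vmul.

Definition gena : Z2Z3 := @MkZ2Z3 [:: LA] isT.
Definition genb : Z2Z3 := @MkZ2Z3 [:: LB true] isT.

Definition bpow (e : bool) : Z2Z3 := if e then genb else genb^-1.

Definition letter_val (l : letter) : Z2Z3 := if l is LB e then bpow e else gena.

Definition word_val (w : seq letter) : Z2Z3 := \prod_(l <- w) letter_val l.

Lemma val_word_val w : val (word_val w) = foldr push [::] w.
Proof.
elim: w => [|l w IH]; first by rewrite /word_val big_nil.
rewrite /word_val big_cons -[X in _ * X]/(word_val w) /= -IH.
by case: l => [|[]].
Qed.

Lemma word_valK (x : Z2Z3) : word_val (val x) = x.
Proof.
by apply: val_inj; rewrite val_word_val act_cat cats0 //; exact: Z2Z3_reduced.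
Qed.

Lemma gena2 : gena ^+ 2 = 1. Proof. exact: val_inj. Qed.
Lemma genb3 : genb ^+ 3 = 1. Proof. exact: val_inj. Qed.

Lemma free_product_univ (H : groupType) (x y : H) :
  x ^+ 2 = 1 -> y ^+ 3 = 1 ->
  exists! f : Z2Z3 -> H,
    [/\ {morph f : u v / u * v >-> u * v}, f gena = x & f genb = y].
Proof.
move=> x2 y3; pose h l := if l is LB e then if e then y else y^-1 else x.
pose F (w : seq letter) := \prod_(l <- w) h l.
have Fc l w : F (l :: w) = h l * F w by rewrite /F big_cons.
have xx : x * x = 1 by rewrite -expg2.
have yy : y * y = y^-1.
  by apply: (mulIg y); rewrite mulVg -mulgA; exact: y3.
have yyV : y^-1 * y^-1 = y by rewrite -invgM yy invgK.
have Fp l w : F (push l w) = h l * F w.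
  case: l w => [|[]] [|[|[]] w] //=; rewrite ?Fc //= mulgA ?xx ?yy ?yyV;
  by rewrite ?mulgV ?mulVg ?mul1g.
have FM u v : F (foldr push v u) = F u * F v.
  elim: u => /= [|l u IH]; first by rewrite {2}/F big_nil mul1g.
  by rewrite Fp IH Fc mulgA.
exists (fun u => F (val u)); split.
  split; first by move=> u v; exact: FM.
    by rewrite /F big_seq1.
  by rewrite /F big_seq1.
move=> f [fM fa fb]; apply: funext => u.
have f1 : f 1 = 1 by apply: (mulIg (f 1)); rewrite -fM !mul1g.
have fV v : f v^-1 = (f v)^-1.
  by apply: (mulIg (f v)); rewrite -fM !mulVg.
rewrite -[in RHS](word_valK u); elim: (val u) => [|l w IH].
  by rewrite /F /word_val !big_nil f1.
rewrite Fc IH /word_val big_cons fM; congr (_ * _).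
by case: l => [|[]] /=; rewrite ?fV ?fa ?fb.
Qed.

Lemma word_len_ex (x : Z2Z3) :
  exists n, [exists w : n.-tuple letter, word_val w == x].
Proof.
exists (size (val x)); apply/existsP; exists (in_tuple (val x)).
by rewrite /= word_valK.
Qed.

(* minimum length of a word in {a, b, b^-1} representing [x] *)
Definition word_len (x : Z2Z3) : nat := ex_minn (word_len_ex x).

Lemma word_lenE x : word_len x = size (val x).
Proof.
rewrite /word_len; case: ex_minnP => n /existsP[w /eqP wx] minn.
apply/eqP; rewrite eqn_leq minn /=; last first.
  by apply/existsP; exists (in_tuple (val x)); rewrite /= word_valK.
rewrite -wx val_word_val -[n in (_ <= n)%N](size_tuple w).
elim: (val w) => //= l s; move: (foldr _ _ s) => v IH.
apply: leq_trans (_ : (size v).+1 <= _)%N => //.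
by case: l v {IH} => [|e] [|[|e'] v] //=; [exact: leqW | case: ifP => _ //=; exact: leqW].
Qed.

Definition conj_class (x : Z2Z3) : set Z2Z3 := range (conjg x).

Definition class_len (c : set Z2Z3) (n : nat) : Prop :=
  (exists2 x, c x & word_len x = n) /\ (forall x, c x -> (n <= word_len x)%N).

Definition order2 (x : Z2Z3) : Prop := x <> 1 /\ x ^+ 2 = 1.

Definition infinite_order (x : Z2Z3) : Prop :=
  forall n, (0 < n)%N -> x ^+ n <> 1.

Definition reciprocal : set Z2Z3 :=
  [set z | exists x y, [/\ order2 x, order2 y, x <> y & z = x * y]].

(* R_n: here n is the length of the class, not of the chosen element. *)
Definition reciprocal_classes (n : nat) : set (set Z2Z3) :=
  [set c | class_len c n] `&` conj_class @` reciprocal.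

(* a b^e1 a b^e2 ... a b^es, with [true] for +1 and [false] for -1 *)
Definition ab_word (s : seq bool) : Z2Z3 := \prod_(e <- s) (gena * bpow e).

(* The sequence is read cyclically and may wrap around more than once: a
   constant sequence is not m-low lying, whatever its length. *)
Definition low_lying_signs (m : nat) (s : seq bool) : Prop :=
  forall i, ~ (forall j, (j <= m)%N ->
    nth true s ((i + j) %% size s) = nth true s (i %% size s)).

Definition low_lying (m : nat) (x : Z2Z3) : Prop :=
  infinite_order x /\
  exists s, [/\ s <> [::], conj_class (ab_word s) x & low_lying_signs m s].

Definition low_lying_words (n m : nat) : set Z2Z3 :=
  [set x | low_lying m x /\ word_len x = n].

Definition low_lying_classes (n m : nat) : set (set Z2Z3) :=
  conj_class @` low_lying_words n m.

(* x y x^-1 y^-1, whereas [~ x, y] is x^-1 y^-1 x y *)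
Definition comm (x y : Z2Z3) : Z2Z3 := x * y * x^-1 * y^-1.

Definition is_bb_word (x : Z2Z3) : bool :=
  is_b (head LA (val x)) && is_b (last LA (val x)).

(* N_{4t} *)
Definition commutator_words (t : nat) : set Z2Z3 :=
  [set comm gena y | y in [set y | is_bb_word y /\ word_len y = (2 * t - 1)%N]].

(* b^e1 a b^e2 ... a b^et *)
Definition bb_word (s : seq bool) : Z2Z3 :=
  if s is e :: s' then bpow e * ab_word s' else 1.

Definition compositions (t : nat) : set (seq nat) :=
  [set k | all (leq 1) k /\ sumn k = t].

Definition bounded_compositions (t m : nat) : set (seq nat) :=
  compositions t `&` [set k | all (geq m) k].

(* lengths of the maximal constant runs, from the left *)
Fixpoint run_lengths (s : seq bool) : seq nat :=
  if s is e :: s' then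
    let k := run_lengths s' in
    if e == head (~~ e) s' then incr_nth k 0 else 1%N :: k
  else [::].

(* [s] is determined by [comm gena (bb_word s)], see [gmapE]. *)
Definition gmap (x : Z2Z3) : seq nat :=
  run_lengths (xget [::] [set s | x = comm gena (bb_word s)]).

Fixpoint ab_letters (s : seq bool) : seq letter :=
  if s is e :: s' then [:: LA, LB e & ab_letters s'] else [::].

Lemma val_ab_word s : val (ab_word s) = ab_letters s.
Proof.
elim: s => [|e s IH]; first by rewrite /ab_word big_nil.
rewrite /ab_word big_cons -[X in _ * X]/(ab_word s) -mulgA.
have -> : val (gena * (bpow e * ab_word s)) = push LA (push (LB e) (val (ab_word s))).
  by case: e.
by rewrite IH; case: (s).
Qed.

Lemma val_bb_word e s : val (bb_word (e :: s)) = LB e :: ab_letters s.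
Proof.
have -> : val (bb_word (e :: s)) = push (LB e) (val (ab_word s)) by case: e.
by rewrite val_ab_word; case: s.
Qed.

Lemma bb_wordP t y : (0 < t)%N ->
  (is_bb_word y /\ word_len y = (2 * t - 1)%N) <->
  (exists2 s, size s = t & y = bb_word s).
Proof.
move=> t0; have szab s : size (ab_letters s) = (2 * size s)%N.
  by elim: s => //= e s ->; rewrite mulnS.
rewrite word_lenE /is_bb_word; split; last first.
  case=> -[|e s] /= sz ->; first by rewrite -sz in t0.
  rewrite val_bb_word /= szab -sz; split; last by rewrite mulnS add2n subn1.
  by elim: s e {sz} => //= e' s IH e.
case=> /andP[hy ly] szy; have ry := Z2Z3_reduced y.
have E n (w : seq letter) (e : bool) : (size w < n)%N -> reduced (LB e :: w) ->
    is_b (last (LB e) w) -> exists s, w = ab_letters s.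
  elim: n w e => // n IH [|[|e1] [|[|e2] w]] e //=; first by exists [::].
  rewrite ltnS => lt_n rw lw.
  by have [|s ->] := IH w e2 (ltnW lt_n) _ lw; last by exists (e2 :: s).
case def_y: (val y) hy ly szy ry => [|[|e] w] //= _ lw szy ry.
have [s def_w] := E _ w e (ltnSn _) ry lw.
exists (e :: s); last by apply: val_inj; rewrite val_bb_word -def_w -def_y.
move: szy; rewrite def_w szab /=; case: t t0 => // t _.
by rewrite mulnS add2n subn1 /= => -[/eqP]; rewrite eqn_pmul2l // => /eqP->.
Qed.

Lemma ab_word_inj : injective ab_word.
Proof.
move=> s1 s2 /(congr1 val); rewrite !val_ab_word.
by elim: s1 s2 => [|e s1 IH] [|e2 s2] //= [-> /IH ->].
Qed.

Lemma comm_bb_word s :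
  comm gena (bb_word s) = ab_word (s ++ rev (map negb s)).
Proof.
have aV : gena^-1 = gena by exact: val_inj.
have bV e : (bpow e)^-1 = bpow (~~ e) by case: e; rewrite //= invgK.
pose ba_word (s' : seq bool) := \prod_(e <- s') (bpow e * gena).
have ab_ba s' : ab_word s' * gena = gena * ba_word s'.
  rewrite /ab_word /ba_word; elim: s' => [|e s' IH].
    by rewrite !big_nil mul1g mulg1.
  by rewrite !big_cons -mulgA IH !mulgA.
have baV s' : (ba_word s')^-1 = ab_word (rev (map negb s')).
  rewrite /ba_word /ab_word; elim: s' => [|e s' IH].
    by rewrite !big_nil invg1.
  rewrite big_cons /= rev_cons -cats1 big_cat big_seq1.
  by rewrite !invgM IH aV bV.
have -> : ab_word (s ++ rev (map negb s)) = ab_word s * (ba_word s)^-1.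
  by rewrite baV /ab_word big_cat.
case: s => [|e s]; first by rewrite /comm /ab_word /ba_word !big_nil invg1 !mulg1 mulgV.
rewrite /comm -[LHS]mulgA -invgM /= -[X in X^-1]mulgA ab_ba.
by rewrite /ab_word /ba_word !big_cons !mulgA.
Qed.

Lemma gmapE s : gmap (comm gena (bb_word s)) = run_lengths s.
Proof.
rewrite /gmap; congr run_lengths; apply: xget_unique => // s' /=.
rewrite !comm_bb_word => /ab_word_inj ss'.
have sz : size s = size s'.
  have /eqP := congr1 size ss'; rewrite !size_cat !size_rev !size_map !addnn.
  by rewrite -!muln2 eqn_pmul2r // => /eqP.
by move/eqP: ss'; rewrite eqseq_cat // => /andP[/eqP].
Qed.

(* Main.v *)
(* The commutator of a and b^e1 a ... a b^et is the (ab)-word of the sign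
   sequence s ++ rev (- s), where s = (e1, ..., et).  Conjugate (ab)-words have
   cyclically equivalent sign sequences, and an element conjugate to its inverse
   has a cyclic sign sequence with an antipalindromic reflection; such a cyclic
   sequence has exactly two antipalindromic starting points, so the fibres of pi
   have two elements.  The fibres of g are the pairs {s, - s}, and negation
   permutes the fibres of pi while reversing the lexicographic order.  Hence
   exactly one of s, - s is the least element of its fibre of pi, and sending a
   class to the run lengths of the least sequence representing it is a
   bijection. *)
Require Import Defs.
From mathcomp Require Import all_boot.
From mathcomp Require Import boolp classical_sets functions.
From mathcomp Require Import zify.
Local Open Scope classical_set_scope.

Section ReciprocalClasses.

Set Implicit Arguments.
Unset Strict Implicit.
Local Open Scope group_scope.

(** * Word length and powers of (ab)-words *)

Lemma size_push l w : (size (push l w) <= (size w).+1)%N.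
Proof.
case: l w => [|e] [|[|e'] w] //=; first exact: leqW.
by case: ifP => _ //=; exact: leqW.
Qed.

Lemma word_len_mul x y : (word_len (x * y)%g <= word_len x + word_len y)%N.
Proof.
rewrite !word_lenE /=; elim: (normal_form x) => //= l u IH.
by apply: leq_trans (size_push _ _) _.
Qed.

Lemma word_len_inv x : word_len (x^-1) = word_len x.
Proof. by rewrite !word_lenE /= size_rev size_map. Qed.

Lemma word_len_exp x n : (word_len (x ^+ n)%g <= n * word_len x)%N.
Proof.
elim: n => [|n IH]; first by rewrite expg0 word_lenE.
by rewrite expgS mulSn (leq_trans (word_len_mul _ _)) // leq_add2l.
Qed.

Lemma size_ab_letters s : size (ab_letters s) = (2 * size s)%N.
Proof. by elim: s => //= e s ->; rewrite mulnS. Qed.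

Lemma word_len_ab s : word_len (ab_word s) = (2 * size s)%N.
Proof. by rewrite word_lenE val_ab_word size_ab_letters. Qed.

Lemma ab_word_cat s u : ab_word (s ++ u) = ab_word s * ab_word u.
Proof. by rewrite /ab_word big_cat. Qed.

Lemma ab_word_exp s n : ab_word s ^+ n = ab_word (flatten (nseq n s)).
Proof.
elim: n => [|n IH]; first by rewrite expg0 /ab_word big_nil.
by rewrite expgS IH /= ab_word_cat.
Qed.

Lemma size_flatten_nseq (T : Type) (s : seq T) n :
  size (flatten (nseq n s)) = (n * size s)%N.
Proof. by elim: n => //= n IH; rewrite size_cat IH mulSn. Qed.

(* Translation length: |x^n| <= n |x|, while |(ab_word s)^n| = 2 n (size s)
   changes by at most 2 |g| under conjugation by g. *)
Lemma word_len_conj_ab s g : (2 * size s <= word_len (ab_word s ^ g)%g)%N.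
Proof.
set x := ab_word s ^ g; rewrite leqNgt; apply/negP => ltx.
(* If x were shorter than 2 (size s), the n-th power would save at least n letters, while
   conjugation by g accounts for at most 2 |g|; this n exceeds that. *)
pose n := (2 * word_len g).+1.
have : (n * (2 * size s) <= word_len g + (n * word_len x + word_len g))%N.
  have <- : word_len (g * (x ^+ n * g^-1)) = (n * (2 * size s))%N.
    rewrite /x -conjXg conjgE !mulgA mulgV mul1g mulgK.
    by rewrite ab_word_exp word_len_ab size_flatten_nseq mulnCA.
  apply: leq_trans (word_len_mul _ _) _; rewrite leq_add2l.
  apply: leq_trans (word_len_mul _ _) _; rewrite word_len_inv leq_add2r.
  exact: word_len_exp.
have : (n * (word_len x).+1 <= n * (2 * size s))%N by rewrite leq_mul2l ltx orbT.
by rewrite mulnS /n; lia.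
Qed.

Lemma ab_word_infinite_order s : s <> [::] -> infinite_order (ab_word s).
Proof.
move=> s0 n n0 /(congr1 word_len).
rewrite ab_word_exp word_len_ab size_flatten_nseq word_lenE /=.
by case: s s0 => // e s _/=; nia.
Qed.

(** * Cyclic sign sequences as periodic functions, and conjugacy of (ab)-words *)

Definition cyc (s : seq bool) (i : nat) : bool := nth true s (i %% size s).

Lemma cycM s i k : cyc s (i + k * size s) = cyc s i.
Proof. by rewrite /cyc addnC modnMDl. Qed.

Lemma cyc_inj s s' : size s = size s' -> cyc s =1 cyc s' -> s = s'.
Proof.
move=> sz E; apply: (@eq_from_nth _ true) => // i lti.
by have := E i; rewrite /cyc -sz modn_small.
Qed.

Lemma cyc_rot s k i : (k <= size s)%N -> cyc (rot k s) i = cyc s (k + i).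
Proof.
case: (posnP (size s)) => [/size0nil-> | s0 lek]; first by rewrite /cyc !nth_nil.
rewrite /cyc size_rot -modnDmr; have := ltn_pmod i s0.
move: (i %% size s)%N => {}i lti; rewrite /rot nth_cat size_drop nth_drop.
case: ltnP => H; first by rewrite modn_small //; lia.
rewrite nth_take; last by lia.
have -> : (k + i = (i - (size s - k)) + size s)%N by lia.
by rewrite modnDr modn_small //; lia.
Qed.

Lemma nth_flatten_nseq s n p : (p < n * size s)%N ->
  nth true (flatten (nseq n s)) p = cyc s p.
Proof.
elim: n p => //= n IH p ltp; rewrite nth_cat.
case: ltnP => H; first by rewrite /cyc modn_small.
rewrite IH; last by lia.
by rewrite -(cycM _ (p - size s) 1) mul1n subnK.
Qed.

Lemma nth_ab_letters s p : (p < size s)%N ->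
  nth LA (ab_letters s) p.*2 = LA /\
  nth LA (ab_letters s) p.*2.+1 = LB (nth true s p).
Proof. by elim: s p => //= e s IH [|p] //= /IH. Qed.

Lemma is_b_nth_ab_letters s p : (p < 2 * size s)%N ->
  is_b (nth LA (ab_letters s) p) = odd p.
Proof.
move=> ltp; have lt2 : (p./2 < size s)%N by lia.
rewrite -{1}(odd_double_half p); have [E1 E2] := nth_ab_letters lt2.
by case: (odd p); rewrite /= ?add1n ?add0n ?E1 ?E2.
Qed.

(** Each letter of x, multiplied on the left, only touches the front: it is prepended, cancels the
    first letter, or replaces it (b b = b^-1). So at most one letter per factor is lost on either
    side. *)
Lemma mul_tail x y : exists i j,
  [/\ (i <= word_len x)%N, (j <= word_len x)%N &
      drop i (val (x * y)) = drop j (val y)].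
Proof.
rewrite !word_lenE /=; elim: (normal_form x) => [|l u [i [j [lei lej E]]]].
  by exists 0%N, 0%N.
have [i1 [j1 [lei1 lej1 E1]]] : exists i1 j1, [/\ (i1 <= 1)%N, (j1 <= 1)%N &
    drop i1 (push l (foldr push y u)) = drop j1 (foldr push y u)].
  case: l (foldr _ _ u) => [|e] [|[|e'] w] /=.
  - by exists 1%N, 0%N.
  - by exists 0%N, 1%N; rewrite /= ?drop0.
  - by exists 1%N, 0%N; rewrite /= ?drop0.
  - by exists 1%N, 0%N.
  - by exists 1%N, 0%N; rewrite /= ?drop0.
  case: ifP => _; first by exists 1%N, 1%N.
  by exists 0%N, 1%N; rewrite /= ?drop0.
exists (i + i1)%N, (j + j1)%N; split => /=; try lia.
by rewrite -drop_drop E1 drop_drop addnC -drop_drop E drop_drop addnC.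
Qed.

(** Mirror image of [mul_tail]: inversion reverses normal forms and turns dropped fronts into
    dropped ends. *)
Lemma mul_prefix x y : exists i j,
  [/\ (i <= word_len y)%N, (j <= word_len y)%N &
      take (word_len (x * y)%g - i) (val (x * y)) = take (word_len x - j) (val x)].
Proof.
have [i [j [lei lej]]] := mul_tail y^-1 x^-1; rewrite word_len_inv in lei lej.
rewrite -invgM => /(congr1 inv_word) E; exists i, j; split => //; move: E.
have invd (z : Z2Z3) k : inv_word (drop k (val z^-1)) = take (word_len z - k) (val z).
  have -> : val z^-1 = inv_word (val z) by [].
  rewrite /inv_word drop_rev size_map -map_take map_rev revK word_lenE.
  rewrite -map_comp -[RHS]map_id.
  by apply: eq_map => -[|[]].
by rewrite !invd.
Qed.

(** For large N, the element v = g^-1 (ab_word s)^N = (ab_word s')^N g^-1 agrees with the first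
    power away from its beginning and with the second away from its end. The common window is longer
    than a period, so the signs agree up to a shift. *)
Lemma conj_ab_word_cyc s s' g : size s' = size s -> ab_word s' = ab_word s ^ g ->
  exists k, forall i, cyc s' i = cyc s (k + i).
Proof.
move=> sz Eg.
case: (posnP (size s)) => [s0 | s0].
  exists 0%N => i; move/size0nil: (s0) => ->.
  by rewrite s0 in sz; move/size0nil: sz => ->.
set L := size s in s0 sz; pose N := (3 * word_len g + 2)%N.
pose W := flatten (nseq N s); pose W' := flatten (nseq N s').
have szW : size W = (N * L)%N by exact: size_flatten_nseq.
have szW' : size W' = (N * L)%N by rewrite size_flatten_nseq sz.
have EW : g^-1 * ab_word W = ab_word W' * g^-1.
  by rewrite -!ab_word_exp Eg -conjXg conjgE !mulgA mulgK.
have [i [j [lei lej E1]]] := mul_tail g^-1 (ab_word W).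
have [i' [j' [lei' lej' E2]]] := mul_prefix (ab_word W') g^-1.
rewrite -EW in E2; set v := _ * ab_word W in E1 E2.
rewrite word_len_inv in lei lej lei' lej'.
have lev : (2 * (N * L) <= word_len v + word_len g)%N.
  have -> : (2 * (N * L))%N = word_len (g * v).
    by rewrite /v mulgA mulgV mul1g word_len_ab szW.
  by rewrite addnC word_len_mul.
rewrite word_len_ab szW' !val_ab_word in E1 E2.
have bigN : (2 * L + 3 * word_len g <= 2 * (N * L))%N by rewrite /N; nia.
have key q : (q < 2 * L)%N ->
    nth LA (ab_letters W') (i + q) = nth LA (ab_letters W) (j + q).
  move=> ltq; rewrite -[RHS]nth_drop -E1 nth_drop.
  rewrite -[RHS](@nth_take (word_len v - i')); last by lia.
  by rewrite E2 nth_take //; lia.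
(* In an (ab)-word the b-letters are those in odd position, so equal letters force equal parity. *)
have par : odd i = odd j.
  have /(congr1 is_b) := key 0%N ltac:(lia).
  by rewrite !addn0 !is_b_nth_ab_letters ?szW ?szW' //; lia.
have cycE p : cyc s' (p + i./2) = cyc s (p + j./2).
  have small q : (q < L)%N -> cyc s' (q + i./2) = cyc s (q + j./2).
    (* The correction [~~ odd i] makes the position odd, so that a sign is read there. *)
    move=> ltq; have := key (q.*2 + ~~ odd i)%N ltac:(lia).
    have -> : (i + (q.*2 + ~~ odd i) = (q + i./2).*2.+1)%N by lia.
    have -> : (j + (q.*2 + ~~ odd i) = (q + j./2).*2.+1)%N by lia.
    rewrite (nth_ab_letters _).2 ?szW' ?(nth_ab_letters _).2 ?szW; try lia.
    by move=> [/[!nth_flatten_nseq]]//; rewrite ?sz //; lia.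
  have := small (p %% L)%N (ltn_pmod _ s0).
  have -> : cyc s' (p %% L + i./2) = cyc s' (p + i./2) by rewrite /cyc sz modnDml.
  by rewrite {2}/cyc modnDml.
(* The shift is j/2 - i/2 modulo L, with -1 replaced by L - 1 to stay in nat. *)
exists (i./2 * L.-1 + j./2)%N => x.
rewrite -(cycM _ _ i./2) sz.
have -> : (x + i./2 * L = (x + i./2 * L.-1) + i./2)%N by rewrite /L in s0 *; nia.
by rewrite cycE; congr cyc; lia.
Qed.

Lemma conj_class_eq x y : conj_class x y -> conj_class y = conj_class x.
Proof.
move=> [g _ <-]; apply/seteqP; split => z [h _ <-].
  by exists (g * h); rewrite ?conjgM.
by exists (g^-1 * h); rewrite // -conjgM mulgA mulgV mul1g.
Qed.

Lemma conj_class_refl x : conj_class x x.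
Proof. by exists 1; rewrite ?conjg1. Qed.

Lemma conj_class_cyc s s' : size s' = size s ->
  conj_class (ab_word s') = conj_class (ab_word s) <->
  exists k, forall i, cyc s' i = cyc s (k + i).
Proof.
move=> sz; split.
  move=> E; have : conj_class (ab_word s) (ab_word s').
    by rewrite -E; exact: conj_class_refl.
  by move=> [g _ /esym]; exact: conj_ab_word_cyc.
move=> [k Ek]; apply: conj_class_eq.
case: (posnP (size s)) => [s0 | s0].
  rewrite s0 in sz; move/size0nil: sz => ->; move/size0nil: s0 => ->.
  exact: conj_class_refl.
have -> : s' = rot (k %% size s) s.
  apply: cyc_inj; rewrite ?size_rot // => i.
  by rewrite Ek cyc_rot ?(ltnW (ltn_pmod _ s0)) // /cyc modnDml.
move: (k %% size s)%N => {Ek}k; rewrite -{1}(cat_take_drop k s) /rot !ab_word_cat.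
exists (ab_word (take k s)) => //.
by rewrite conjgE !mulgA mulVg mul1g.
Qed.

(** * Doubled sequences and antipalindromes *)

Definition dbl (s : seq bool) : seq bool := s ++ rev (map negb s).

Lemma size_dbl s : size (dbl s) = (2 * size s)%N.
Proof. by rewrite size_cat size_rev size_map addnn mul2n. Qed.

Lemma dbl_negb s : dbl (map negb s) = map negb (dbl s).
Proof. by rewrite /dbl map_cat map_rev. Qed.

Lemma rev_negb_dbl s : rev (map negb (dbl s)) = dbl s.
Proof. by rewrite /dbl map_cat rev_cat map_rev revK (mapK negbK). Qed.

Lemma dbl_inj : injective dbl.
Proof.
move=> s s' E; have sz : size s = size s'.
  by have /(congr1 size) := E; rewrite !size_dbl => /eqP; rewrite eqn_pmul2l // => /eqP.
by move/eqP: E; rewrite /dbl eqseq_cat // => /andP[/eqP].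
Qed.

Lemma cyc_negb s i : (0 < size s)%N -> cyc (map negb s) i = ~~ cyc s i.
Proof. by move=> s0; rewrite /cyc size_map (nth_map true) // ltn_pmod. Qed.

(** Reversal acts on indices modulo the size as i |-> -1 - i; the divisibility hypothesis says,
    without subtraction, that j is the mirror image of i. *)
Lemma cyc_rev_negb s i j : (0 < size s)%N -> size s %| (i + j).+1 ->
  cyc (rev (map negb s)) i = ~~ cyc s j.
Proof.
move=> s0; have -> : (size s %| (i + j).+1) = (size s %| (i %% size s + j %% size s).+1).
  by rewrite -(addn1 (i + j)) -(addn1 (_ + _)) /dvdn -modnDml -[in RHS]modnDml modnDm.
rewrite /cyc size_rev size_map.
have := ltn_pmod i s0; have := ltn_pmod j s0.
move: (i %% size s)%N (j %% size s)%N => {}i {}j ltj lti.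
move=> /dvdnP[q Eq].
(* Both indices are now reduced, so i + j + 1 lies strictly between 0 and twice the size, which
   leaves q = 1. *)
have -> : j = (size s - i.+1)%N by case: q Eq => [|[|q]]; rewrite ?mulSn; lia.
by rewrite nth_rev size_map // (nth_map true) //; lia.
Qed.

(** The reflection i |-> -1 - i of Z/2t has its axes between -1 and 0 and between t - 1 and t, hence
    no fixed point. Applied to f shifted by k, the condition expresses antisymmetry about an axis
    just before k. *)
Definition antipal (t : nat) (f : nat -> bool) :=
  forall i j, 2 * t %| (i + j).+1 -> f i = ~~ f j.

Lemma cyc_dbl_antipal s : (0 < size s)%N -> antipal (size s) (cyc (dbl s)).
Proof.
move=> s0 i j; rewrite -size_dbl => dv.
by rewrite -{1}rev_negb_dbl; apply: cyc_rev_negb; rewrite // size_dbl muln_gt0.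
Qed.

Lemma cyc_dblM s i k : cyc (dbl s) (i + k * (2 * size s)) = cyc (dbl s) i.
Proof. by rewrite -size_dbl cycM. Qed.

(** The reflection exchanges the two halves of a period, so the first half determines f. *)
Lemma antipal_dbl t f : (0 < t)%N -> (forall i k, f (i + k * (2 * t)) = f i) ->
  antipal t f -> cyc (dbl (mkseq f t)) =1 f.
Proof.
move=> t0 per anti; have szt : size (mkseq f t) = t by exact: size_mkseq.
have lt_t i : (i < t)%N -> cyc (dbl (mkseq f t)) i = f i.
  move=> lti; rewrite /cyc size_dbl szt modn_small; last by lia.
  by rewrite nth_cat szt lti nth_mkseq.
have perd := cyc_dblM (mkseq f t); rewrite szt in perd.
move=> i; rewrite (divn_eq i (2 * t)) addnC perd per.
have := ltn_pmod i (ltac:(lia) : 0 < 2 * t)%N.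
move: (i %% (2 * t))%N => {}i lti; case: (ltnP i t) => [/lt_t //|lei].
have dv : 2 * t %| (i + (2 * t - i.+1)).+1 by apply/dvdnP; exists 1%N; lia.
rewrite (anti _ _ dv) -lt_t; last by lia.
by apply: (cyc_dbl_antipal (s := mkseq f t)); rewrite szt.
Qed.

(* The composite of the reflections of Z/2t centred at 0 and at k is the
   translation by 2k. *)
Lemma antipal_shift t f k : (0 < t)%N ->
  (forall i k, f (i + k * (2 * t)) = f i) -> antipal t f ->
  antipal t (fun i => f (k + i)%N) <-> (forall i, f (k.*2 + i) = f i).
Proof.
move=> t0 per anti; split => [antik i | perk i j dv].
  (* A natural number congruent to -1 - (k + i) modulo 2t. *)
  pose j := ((k + i).+1 * (2 * t) - (k + i).+1)%N.
  have dv1 : 2 * t %| (i + (k + j)).+1.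
    by apply/dvdnP; exists (k + i).+1; rewrite /j; nia.
  have dv2 : 2 * t %| ((k + i) + j).+1 by rewrite addnAC -addnA addnC; move: dv1; congr (_ %| _.+1); lia.
  by rewrite (anti _ _ dv1) -addnn -addnA (antik _ _ dv2).
have -> : f (k + j) = f (j + k * (2 * t) - k)%N.
  rewrite -(perk (_ - _)%N) -(per (k + j)%N k); congr f; nia.
apply: anti; have -> : ((k + i + (j + k * (2 * t) - k)) = (i + j) + k * (2 * t))%N by nia.
by rewrite -addSn dvdn_addl // dvdn_mull.
Qed.

(* The shifts making f antipalindromic are the multiples of the least positive
   one d; 2d is a period of f, and d itself is not one: halving it gives a
   smaller shift if d is even, a fixed point of a reflection if d is odd. *)
Lemma antipal_shifts t f : (0 < t)%N ->
  (forall i k, f (i + k * (2 * t)) = f i) -> antipal t f ->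
  exists d, [/\ antipal t (fun i => f (d + i)%N),
    ~ (forall i, f (d + i) = f i)%N &
    forall k, antipal t (fun i => f (k + i)%N) ->
      (forall i, f (k + i) = f i)%N \/ (forall i, f (k + i) = f (d + i))%N].
Proof.
move=> t0 per anti.
have exP : exists d, (0 < d)%N && `[< forall i, f (d.*2 + i)%N = f i >].
  exists t; rewrite t0; apply/asboolP => i.
  by rewrite -mul2n addnC -[X in (i + X)%N]mul1n per.
case: (ex_minnP exP) => d /andP[d0 /asboolP perd] mind.
have mperd q i : f ((q * d).*2 + i) = f i.
  by elim: q => //= q IH; rewrite mulSn doubleD -addnA perd.
exists d; split; first exact/antipal_shift.
- move=> perd1; have [/eqP odd_d|even_d] := boolP (odd d == true).
    have := anti d./2 (d * (2 * t) - d./2.+1)%N.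
    have -> : (d./2 + (d * (2 * t) - d./2.+1)).+1 = (d * (2 * t))%N by nia.
    rewrite dvdn_mull // => /(_ isT); rewrite -[f (_ - _)%N]perd1.
    have -> : (d + (d * (2 * t) - d./2.+1) = d./2 + d * (2 * t))%N by nia.
    by rewrite per; case: (f _).
  have : (d <= d./2)%N; last by lia.
  apply: mind; apply/andP; split; first by lia.
  by apply/asboolP => i; have -> : (d./2).*2 = d by lia.
move=> k /(antipal_shift _ t0 per anti) perk.
have Ek := divn_eq k d; have ltr := ltn_pmod k d0.
move: (k %/ d)%N (k %% d)%N Ek ltr => q r Ek ltr.
have r0 : r = 0%N.
  apply/eqP; rewrite -leqn0 leqNgt; apply/negP => r0.
  have : (d <= r)%N; last by lia.
  apply: mind; rewrite r0; apply/asboolP => i.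
  by rewrite -(mperd q) addnA -doubleD -Ek perk.
(* As k = q d and 2d is a period, only the parity of q matters: the shifts 0 and d remain. *)
have shiftq i : f (k + i) = f (odd q * d + i)%N.
  rewrite -[RHS](mperd q./2); congr f; rewrite Ek r0 addn0 addnA; congr (_ + _)%N.
  by rewrite -[q in LHS]odd_double_half mulnDl -doubleMl addnC.
by case: (odd q) shiftq => H; [right | left] => i; rewrite H ?mul1n ?mul0n.
Qed.

(** * Fibres of pi and their least elements *)

Definition recip_class (s : seq bool) : set Z2Z3 := conj_class (comm gena (bb_word s)).

Lemma recip_classE s : recip_class s = conj_class (ab_word (dbl s)).
Proof. by rewrite /recip_class comm_bb_word. Qed.

Lemma recip_class_cyc s s' : size s' = size s ->
  recip_class s' = recip_class s <->
  exists k, forall i, cyc (dbl s') i = cyc (dbl s) (k + i).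
Proof. by move=> sz; rewrite !recip_classE; apply: conj_class_cyc; rewrite !size_dbl sz. Qed.

(** The second point of the fibre is the half period of [dbl s] read from the other antipalindromic
    starting point d given by [antipal_shifts]. *)
Lemma recip_class_fibre s : (0 < size s)%N -> exists s',
  [/\ size s' = size s, s' <> s, recip_class s' = recip_class s &
      forall u, size u = size s -> recip_class u = recip_class s -> u = s \/ u = s'].
Proof.
move=> s0; have anti := cyc_dbl_antipal s0.
have [d [antid nperd dP]] := antipal_shifts s0 (cyc_dblM s) anti.
have perd i k : cyc (dbl s) (d + (i + k * (2 * size s))) = cyc (dbl s) (d + i).
  by rewrite addnA cyc_dblM.
have Es' := antipal_dbl s0 perd antid.
exists (mkseq (fun i => cyc (dbl s) (d + i)%N) (size s)); split.
- exact: size_mkseq.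
- by move=> E; apply: nperd => i; rewrite -Es' E.
- by apply/recip_class_cyc; [exact: size_mkseq | exists d].
move=> u szu /(recip_class_cyc szu)[k Ek].
have antik : antipal (size s) (fun i => cyc (dbl s) (k + i)%N).
  move=> i j dv; rewrite -!Ek -szu in dv *.
  by apply: (@cyc_dbl_antipal u); rewrite // szu.
by case: (dP k antik) => H; [left | right]; apply/dbl_inj/cyc_inj;
  rewrite ?size_dbl ?size_mkseq ?szu // => i; rewrite Ek H // Es'.
Qed.

Lemma recip_class_negb s s' : size s' = size s -> (0 < size s)%N ->
  recip_class s' = recip_class s ->
  recip_class (map negb s') = recip_class (map negb s).
Proof.
move=> sz s0 /(recip_class_cyc sz)[k Ek]; apply/recip_class_cyc.
  by rewrite !size_map.
by exists k => i; rewrite !dbl_negb !cyc_negb ?Ek ?size_dbl ?sz ?muln_gt0.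
Qed.

(* Any total strict order on sign sequences that negation reverses would do. *)
Fixpoint slt (s s' : seq bool) : bool :=
  match s, s' with
  | e :: u, e' :: u' => if e == e' then slt u u' else e'
  | _, _ => false
  end.

Lemma sltxx s : slt s s = false.
Proof. by elim: s => //= e s IH; rewrite eqxx. Qed.

Lemma slt_asym s s' : slt s s' -> ~~ slt s' s.
Proof. by elim: s s' => [|[] s IH] [|[] s'] //=; exact: IH. Qed.

Lemma slt_total s s' : size s = size s' -> s <> s' -> slt s s' || slt s' s.
Proof.
elim: s s' => [|e s IH] [|e' s'] //= [sz] ne; rewrite eq_sym.
case: eqP => [Ee|]; last by case: e e' {ne} => [] [].
by apply: IH => // Es; apply: ne; rewrite Ee Es.
Qed.

Lemma slt_negb s s' : slt (map negb s) (map negb s') = slt s' s.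
Proof. by elim: s s' => [|[] s IH] [|[] s'] //=. Qed.

Definition least_sign (s : seq bool) : Prop :=
  forall u, size u = size s -> recip_class u = recip_class s -> ~~ slt u s.

Lemma least_sign_exists s : (0 < size s)%N ->
  exists u, [/\ size u = size s, recip_class u = recip_class s & least_sign u].
Proof.
move=> s0; have [s' [sz _ Cs' fib]] := recip_class_fibre s0.
case: (boolP (slt s' s)) => lt_s's.
  exists s'; split => // u; rewrite sz Cs' => szu Cu.
  by case: (fib u szu Cu) => ->; rewrite ?sltxx // slt_asym.
by exists s; split => // u szu Cu; case: (fib u szu Cu) => -> //; rewrite sltxx.
Qed.

Lemma least_sign_uniq s s' : size s' = size s -> recip_class s' = recip_class s ->
  least_sign s -> least_sign s' -> s' = s.
Proof.
move=> sz C min min'; apply: contrapT => /(slt_total sz).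
by rewrite (negbTE (min _ sz C)) (negbTE (min' _ (esym sz) (esym C))).
Qed.

(** In a fibre of two elements, not being least means being greatest, and negation turns the
    greatest into the least. *)
Lemma least_sign_negb s : (0 < size s)%N -> least_sign (map negb s) <-> ~ least_sign s.
Proof.
move=> s0; have [s' [sz ne Cs' fib]] := recip_class_fibre s0.
split=> [min' min | nmin u].
  have := min' (map negb s'); rewrite !size_map slt_negb => /(_ sz).
  move=> /(_ (recip_class_negb sz s0 Cs')) n1.
  by have := slt_total sz ne; rewrite (negbTE n1) (negbTE (min _ sz Cs')).
have lt_s's : slt s' s.
  apply: contrapT => /negP nlt; apply: nmin => v szv Cv.
  by case: (fib v szv Cv) => -> //; rewrite sltxx.
rewrite size_map => szu Cu.
have szn : size (map negb u) = size s by rewrite size_map.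
have Cn : recip_class (map negb u) = recip_class s.
  rewrite -[s in RHS](mapK negbK).
  by apply: recip_class_negb; rewrite ?size_map.
rewrite -(mapK negbK u) slt_negb.
by case: (fib _ szn Cn) => ->; rewrite ?sltxx // slt_asym.
Qed.

(** * Run lengths and the fibres of g *)

Lemma sumn_run_lengths s : sumn (run_lengths s) = size s.
Proof.
elim: s => //= e s IH; case: ifP => _ /=; last by rewrite IH.
by rewrite -IH; case: (run_lengths s).
Qed.

Lemma run_lengths_gt0 s : all (leq 1) (run_lengths s).
Proof.
elim: s => //= e s IH; case: ifP => _ //=.
by case: (run_lengths s) IH => [|k r] //= /andP[].
Qed.

(** Inverse to [run_lengths] on positive parts once the first sign e is chosen; the two choices of e
    give the two points of a fibre of g. *)
Fixpoint runs (e : bool) (k : seq nat) : seq bool :=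
  if k is n :: k' then nseq n e ++ runs (~~ e) k' else [::].

Lemma size_runs e k : size (runs e k) = sumn k.
Proof. by elim: k e => //= n k IH e; rewrite size_cat size_nseq IH. Qed.

Lemma runs_negb e k : runs (~~ e) k = map negb (runs e k).
Proof. by elim: k e => //= n k IH e; rewrite map_cat map_nseq IH. Qed.

Lemma run_lengths_cons2 e e' s : run_lengths [:: e, e' & s] =
  if e == e' then incr_nth (run_lengths (e' :: s)) 0
  else 1%N :: run_lengths (e' :: s).
Proof. by []. Qed.

Lemma run_lengthsK s : runs (head true s) (run_lengths s) = s.
Proof.
elim: s => [|e [|e' s] IH] //; first by case: e.
rewrite run_lengths_cons2.
move: (run_lengths _) IH => k IH; rewrite -{}[in RHS]IH [head _ _]/= [head _ _]/=.
case: eqP => [->|]; first by case: k.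
by case: e e' => [] [].
Qed.

Lemma runsK e k : all (leq 1) k -> run_lengths (runs e k) = k.
Proof.
elim: k e => //= n k IH e /andP[n0 k1].
have hd : head (~~ e) (runs (~~ e) k) = ~~ e.
  by case: k k1 {IH} => [|[|n'] k].
case: n n0 => // n _; elim: n => [|n IHn] /=.
  by rewrite hd; case: e {hd} => /=; rewrite IH.
by move: IHn => /= ->; rewrite eqxx.
Qed.

Lemma run_lengths_fibre s s' : run_lengths s = run_lengths s' ->
  s' = s \/ s' = map negb s.
Proof.
move=> E; rewrite -(run_lengthsK s) -(run_lengthsK s') E.
by case: (head true s) (head true s') => [] []; rewrite -?runs_negb; [left|right|right|left].
Qed.

(** * Bounded runs and low lying sequences *)

Lemma head_run_lengths e s :
  head 0%N (run_lengths (e :: s)) = (find (predC1 e) s).+1.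
Proof.
elim: s e => [|e' s IH] e; first by case: e.
rewrite run_lengths_cons2 [find _ _]/=.
have {IH} := IH e'; case: (run_lengths _) => // n r /= ->.
by rewrite (eq_sym e'); case: eqP => [->|].
Qed.

(** Linear counterpart of [low_lying_signs]: only windows that fit inside s are tested. *)
Definition short_runs (m : nat) (s : seq bool) : Prop :=
  forall i, (i + m < size s)%N ->
    ~ (forall j, (j <= m)%N -> nth true s (i + j) = nth true s i).

(** By induction: the window at 0 controls the first run, and all other windows are windows of the
    tail. *)
Lemma short_runsP m s : short_runs m s <-> all (geq m) (run_lengths s).
Proof.
elim: s => [|e s IH]; first by split => // _ i.
(* If e continues the first run of s, that run only grows, so bounding the new head bounds the old
   one. *)
have -> : all (geq m) (run_lengths (e :: s)) =
    (head 0%N (run_lengths (e :: s)) <= m)%N && all (geq m) (run_lengths s).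
  rewrite /=; case: ifP => _ /=; case: (run_lengths s) => //= n r.
  by apply/idP/idP; lia.
rewrite head_run_lengths ltnNge; split.
  move=> short; apply/andP; split; last first.
    apply/IH => i lti H; apply: (short i.+1) => // j; exact: H.
  apply/negP => lem; have lems := leq_trans lem (find_size _ _).
  apply: (short 0%N) => // -[|j] // ltj; rewrite add0n /=.
  have := before_find true (leq_trans ltj lem).
  by rewrite /= => /negbFE/eqP.
move=> /andP[nle /IH short] [|i] lti H; last first.
  by apply: (short i) => // j; exact: H.
move/negP: nle; apply; rewrite leqNgt; apply/negP => ltf.
have lts : (find (predC1 e) s < size s)%N by apply: leq_trans ltf _.
have := nth_find true (ltac:(by rewrite has_find) : has (predC1 e) s).
by rewrite /= -[nth _ _ _]/(nth true (e :: s) (0 + (find (predC1 e) s).+1)) H // eqxx.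
Qed.

(** A constant window of [dbl s] cannot cross an axis of the reflection, since the two signs next to
    an axis are opposite. It therefore lies in one half, and a window in the second half mirrors one
    in s. *)
Lemma low_lying_dblP m s : (0 < m)%N -> (0 < size s)%N ->
  low_lying_signs m (dbl s) <-> all (geq m) (run_lengths s).
Proof.
move=> m0 s0; set t := size s in s0 *; rewrite -short_runsP.
have lt_t i : (i < t)%N -> cyc (dbl s) i = nth true s i.
  by move=> lti; rewrite /cyc size_dbl -/t modn_small ?nth_cat ?lti //; lia.
have anti := cyc_dbl_antipal s0; rewrite -/t in anti.
have perd := cyc_dblM s; rewrite -/t in perd.
split => [low i lti H | short i H].
  apply: (low i) => j lej; rewrite -/(cyc _ _) -/(cyc _ _) !lt_t ?H //; lia.
have {}H j : (j <= m)%N -> cyc (dbl s) (i + j) = cyc (dbl s) i by exact: H.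
pose r := (i %% (2 * t))%N.
have Er j : cyc (dbl s) (i + j) = cyc (dbl s) (r + j).
  by rewrite {1}(divn_eq i (2 * t)) -/r -addnA addnC perd.
have {}H j : (j <= m)%N -> cyc (dbl s) (r + j) = cyc (dbl s) r.
  by move=> /H; rewrite Er -[in cyc _ i](addn0 i) Er addn0.
have ltr : (r < 2 * t)%N by rewrite ltn_pmod // muln_gt0.
case: (ltnP r t) => [ltrt | lert].
  have [lt|le] := ltnP (r + m) t.
    by apply: (short r) => // j lej; rewrite -!lt_t ?H //; lia.
  (* The window contains the opposite signs at t - 1 and t. *)
  have dv : 2 * t %| (t + (t - 1)).+1 by apply/dvdnP; exists 1%N; lia.
  have := anti _ _ dv.
  have -> : t = (r + (t - r))%N by lia.
  have -> : (r + (t - r) - 1 = r + (t - 1 - r))%N by lia.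
  by rewrite !H; [case: (cyc _ _) | lia | lia].
have [lt|le] := ltnP (r + m) (2 * t).
  (* The mirror image of the last index r + m, hence the start of the reflected window. *)
  pose q := (2 * t - (r + m).+1)%N.
  have refl j : (j <= m)%N -> cyc (dbl s) (r + j) = ~~ nth true s (q + (m - j)).
    move=> lej; rewrite -lt_t; last by rewrite /q; lia.
    by apply: anti; apply/dvdnP; exists 1%N; rewrite /q; lia.
  apply: (short q); first by rewrite /q -/t; lia.
  move=> j lej; apply: negb_inj.
  have := refl (m - j)%N ltac:(lia); have := refl m (leqnn m).
  rewrite subnn addn0 subKn // => <- <-.
  by rewrite !H //; lia.
(* The window wraps around and contains the opposite signs at 2t - 1 and 2t. *)
have dv : 2 * t %| (2 * t + (2 * t - 1)).+1 by apply/dvdnP; exists 2%N; lia.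
have := anti _ _ dv.
have -> : (2 * t = r + (2 * t - r))%N by lia.
have -> : (r + (2 * t - r) - 1 = r + (2 * t - 1 - r))%N by lia.
by rewrite !H; [case: (cyc _ _) | lia | lia].
Qed.

Lemma low_lying_signs_shift m s s' k :
  (forall i, cyc s' i = cyc s (k + i)) -> low_lying_signs m s -> low_lying_signs m s'.
Proof.
move=> Ek low i H; apply: (low (k + i)%N) => j /H.
by rewrite -!/(cyc _ _) !Ek addnA.
Qed.

(** * Reciprocal classes as classes of commutators *)

Lemma ab_word_rev_negb s :
  ab_word (rev (map negb s)) = gena * (ab_word s)^-1 * gena^-1.
Proof.
have aV : gena^-1 = gena by exact: val_inj.
case: s => [|e s]; first by rewrite /ab_word big_nil invg1 mulg1 mulgV.
have E : ab_word (e :: s) = gena * bb_word (e :: s).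
  by rewrite /= mulgA /ab_word big_cons.
(* After this multiplication the left side is the commutator of [comm_bb_word]. *)
apply: (mulgI (ab_word (e :: s))).
rewrite -ab_word_cat -comm_bb_word E /comm; move: (bb_word _) => y.
by rewrite invgM !aV !mulgA -[RHS]mulgA -expg2 gena2 mulg1.
Qed.

Lemma order2_inv x : order2 x -> x^-1 = x.
Proof. by move=> [_ x2]; apply: (mulgI x); rewrite mulgV -expg2 x2. Qed.

Lemma reciprocal_conj_inv z : reciprocal z -> conj_class z z^-1.
Proof.
move=> [x [y [x2 y2 _ ->]]]; exists x => //.
by rewrite conjgE invgM !order2_inv // !mulgA -{1}(order2_inv x2) mulVg mul1g.
Qed.

Lemma conj_class_inv x y : conj_class x y -> conj_class x^-1 y^-1.
Proof. by move=> [g _ <-]; exists g; rewrite ?conjVg. Qed.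

(* If f is a translate by k of its negated reversal, then k is even, for an odd
   k gives a reflection with a fixed point, where f would equal its negation;
   hence f shifted by k/2 is antipalindromic. *)
Lemma reciprocal_ab_word s t : (0 < t)%N -> size s = (2 * t)%N ->
  (exists2 z, reciprocal z & conj_class z = conj_class (ab_word s)) ->
  exists2 u, size u = t & recip_class u = conj_class (ab_word s).
Proof.
move=> t0 szs [z rz Cz].
have s0 : (0 < size s)%N by rewrite szs muln_gt0.
(* A reciprocal element is conjugate to its inverse, and by [ab_word_rev_negb] inverting a class
   negates and reverses its signs. *)
have : conj_class (ab_word (rev (map negb s))) = conj_class (ab_word s).
  rewrite -Cz -(conj_class_eq (reciprocal_conj_inv rz)).
  have zab : conj_class (ab_word s) z by rewrite -Cz; exact: conj_class_refl.
  rewrite (conj_class_eq (conj_class_inv zab)); apply: conj_class_eq.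
  by exists gena^-1; rewrite // ab_word_rev_negb conjgE invgK !mulgA.
move=> /conj_class_cyc; rewrite size_rev size_map => /(_ erefl)[k Ek].
have refl i j : 2 * t %| (i + j).+1 -> cyc s (k + i) = ~~ cyc s j.
  by rewrite -Ek -szs; exact: cyc_rev_negb.
have per i q : cyc s (i + q * (2 * t)) = cyc s i by rewrite -szs cycM.
have even_k : ~~ odd k.
  (* For odd k this makes k + i its own partner in [refl]. *)
  apply/negP => odd_k; pose i := (k * (2 * t) - k./2.+1)%N.
  have := refl i (k + i)%N.
  have -> : (i + (k + i)).+1 = (k.*2 * (2 * t))%N by rewrite /i; nia.
  by rewrite dvdn_mull // => /(_ isT); case: (cyc _ _).
pose f i := cyc s (k./2 + i).
have antif : antipal t f.
  move=> i j dv; rewrite /f.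
  have := refl (i + k./2 * (2 * t) - k./2)%N (k./2 + j)%N.
  have -> : (i + k./2 * (2 * t) - k./2 + (k./2 + j)).+1 = ((i + j).+1 + k./2 * (2 * t))%N by nia.
  have -> : (k + (i + k./2 * (2 * t) - k./2) = k./2 + i + k./2 * (2 * t))%N by nia.
  by rewrite per; apply; rewrite dvdn_add // dvdn_mull.
have perf i q : f (i + q * (2 * t)) = f i by rewrite /f addnA per.
exists (mkseq f t); first exact: size_mkseq.
rewrite recip_classE; apply/conj_class_cyc; first by rewrite size_dbl size_mkseq.
by exists k./2 => i; rewrite (antipal_dbl t0 perf antif).
Qed.

Lemma recip_class_len s : class_len (recip_class s) (4 * size s).
Proof.
have E : (4 * size s = 2 * size (dbl s))%N by rewrite size_dbl; lia.
rewrite recip_classE; split.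
  by exists (ab_word (dbl s)); [exact: conj_class_refl | rewrite word_len_ab E].
by move=> x [g _ <-]; rewrite E; exact: word_len_conj_ab.
Qed.

Lemma reciprocal_comm s : (0 < size s)%N -> reciprocal (comm gena (bb_word s)).
Proof.
move=> s0; set y := bb_word s; have aV : gena^-1 = gena by exact: val_inj.
have c1 : comm gena y <> 1.
  have := @ab_word_infinite_order (dbl s) _ 1%N isT; rewrite comm_bb_word; apply.
  by move/(congr1 size); rewrite size_dbl /=; lia.
(* The second factor is a conjugate of a; it differs from a because the commutator is not 1. *)
exists gena, (y * gena^-1 * y^-1); split.
- by split; [move/(congr1 val) | exact: val_inj].
- have -> : y * gena^-1 * y^-1 = gena ^ y^-1 by rewrite aV conjgE invgK mulgA.
  split; first by move/(congr1 (fun x => x ^ y)); rewrite conjgKV conj1g => /(congr1 val).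
  by rewrite -conjXg gena2 conj1g.
- by move=> E; apply: c1; rewrite /comm -!mulgA !mulgA -(mulgA gena) -(mulgA gena) -E -expg2 gena2.
by rewrite /comm !mulgA.
Qed.

Lemma low_lying_comm m s : (0 < size s)%N -> low_lying_signs m (dbl s) ->
  low_lying_words (4 * size s) m (comm gena (bb_word s)).
Proof.
move=> s0 low; have d0 : dbl s <> [::].
  by move/(congr1 size); rewrite size_dbl /=; lia.
rewrite comm_bb_word; split; last first.
  by rewrite word_len_ab -/(dbl s) size_dbl; lia.
split; first exact: ab_word_infinite_order.
by exists (dbl s); split => //; exact: conj_class_refl.
Qed.

Lemma low_reciprocal_classesP m t c : (0 < t)%N ->
  (low_lying_classes (4 * t) m `&` reciprocal_classes (4 * t)) c <->
  (exists s, [/\ size s = t, low_lying_signs m (dbl s) & c = recip_class s]).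
Proof.
move=> t0; split; last first.
  move=> [s [szs low ->]]; subst t; split.
    by exists (comm gena (bb_word s)) => //; exact: low_lying_comm.
  split; first exact: recip_class_len.
  by exists (comm gena (bb_word s)) => //; exact: reciprocal_comm.
move=> [[x [[_ [s [s0 sx low]] _] xc]] [[[y cy leny] cmin] [z rz zc]]].
have {xc} cE : c = conj_class (ab_word s) by rewrite -xc (conj_class_eq sx).
(* The low lying witness s comes with no prescribed length. The class has length 4t, contains
   [ab_word s] of length 2 (size s), and by [word_len_conj_ab] contains nothing shorter. *)
have szs : size s = (2 * t)%N.
  have := cmin (ab_word s); rewrite word_len_ab cE => /(_ (conj_class_refl _)).
  by rewrite cE in cy; move: cy leny => [g _ <-]; have := word_len_conj_ab s g; lia.
have [|u szu Cu] := reciprocal_ab_word t0 szs; first by exists z; rewrite // zc.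
exists u; split => //; last by rewrite Cu.
move: Cu; rewrite recip_classE => /conj_class_cyc; rewrite size_dbl szu szs.
by move=> /(_ erefl)[k Ek]; exact: low_lying_signs_shift Ek low.
Qed.

End ReciprocalClasses.

Theorem theorem6p6 (m t : nat) (hm : (2 <= m)%N) (ht : (0 < t)%N) :
  exists Phi : set Z2Z3 -> seq nat,
    set_bij (low_lying_classes (4 * t) m `&` reciprocal_classes (4 * t))
            (bounded_compositions t m) Phi /\
    (forall c, (low_lying_classes (4 * t) m `&` reciprocal_classes (4 * t)) c ->
       exists2 x, (low_lying_words (4 * t) m `&` commutator_words t) x &
                  conj_class x = c /\ gmap x = Phi c).
Proof.
have m0 : (0 < m)%N by apply: ltnW.
(* The default [[::]] is never met on the domain: [least_sign_exists] and [least_sign_uniq] give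
   each class there exactly one such s. *)
pose minrep c := xget [::] [set s | [/\ size s = t, recip_class s = c & least_sign s]].
have minrepE s : size s = t -> least_sign s -> minrep (recip_class s) = s.
  move=> szs min; apply: xget_unique => // s' [szs' C min'].
  by apply: least_sign_uniq; rewrite ?szs.
have domP c : (low_lying_classes (4 * t) m `&` reciprocal_classes (4 * t)) c <->
    exists s, [/\ size s = t, low_lying_signs m (dbl s), c = recip_class s & least_sign s].
  split=> [/(low_reciprocal_classesP _ _ ht)[s [szs low ->]] | [s [szs low Ec _]]]; last first.
    by apply/(low_reciprocal_classesP _ _ ht); exists s.
  have [|u [szu Cu min]] := @least_sign_exists s; first by rewrite szs.
  exists u; split; rewrite ?szu //.
  have [k Ek] := (recip_class_cyc szu).1 Cu.
  (* Being low lying depends only on the cyclic sequence, so it passes to the least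
     representative. *)
  exact: low_lying_signs_shift Ek low.
exists (fun c => run_lengths (minrep c)); split; last first.
  move=> c /domP[s [szs low -> min]]; rewrite (minrepE _ szs min).
  have s0 : (0 < size s)%N by rewrite szs.
  exists (comm gena (bb_word s)); last by rewrite gmapE.
  split; first by rewrite -szs; exact: low_lying_comm.
  by exists (bb_word s) => //; apply/(bb_wordP _ ht); exists s.
split.
- move=> c /domP[s [szs low -> min]]; rewrite (minrepE _ szs min).
  split; first by split; [exact: run_lengths_gt0 | rewrite sumn_run_lengths].
  by apply/low_lying_dblP; rewrite ?szs.
- move=> c c' /set_mem/domP[s [szs low -> min]] /set_mem/domP[s' [szs' low' -> min']].
  (* Injectivity: different sequences with the same run lengths are negatives of each other, and
     these cannot both be least. *)
  rewrite !minrepE // => /run_lengths_fibre[-> // | Es'].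
  by move: min'; rewrite Es' => /least_sign_negb; rewrite szs => /(_ ht).
move=> k [[k1 sumk] km].
(* Surjectivity: of the two sequences with run lengths k, starting with +1 and with -1, one is least
   in its fibre of pi. *)
have [s szs [Es min]] : exists2 s, size s = t & run_lengths s = k /\ least_sign s.
  have sz : size (runs true k) = t by rewrite size_runs.
  have [min | nmin] := pselect (least_sign (runs true k)).
    by exists (runs true k); rewrite // runsK.
  exists (runs false k); rewrite ?size_runs ?runsK //; split=> //.
  by rewrite -[false]/(~~ true) runs_negb; apply/least_sign_negb; rewrite ?sz.
exists (recip_class s); last by rewrite minrepE.
apply/domP; exists s; split => //.
by apply/low_lying_dblP; rewrite ?szs ?Es.
Qed.
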